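(* Let $R$ be a DS-extension of a ring $Q$. Then the topological Hopf $R$-algebra $\hat{S}\hat{\otimes}R\cong\mathrm{Hom}_{\mathbb{Z}}(N,R)$ has a dense Hopf $R$-subalgebra isomorphic to the group algebra $R[N(Q)]$.
   Context: DS-extension: let $Q$ be a subring of a commutative ring $R$ with no zero divisors. $R$ is a DS-extension of $Q$ if there exists an infinite sequence of elements $q_i\in Q$, $i=1,2,\ldots$, such that all differences $q_i-q_j$ with $i\ne j$ are invertible in $R$. For a commutative ring $B$, $N(B)$ is the group, under composition, of formal power series $x(t)=t+x_1t^2+\ldots+x_kt^{k+1}+\ldots$ with $x_i\in B$. The functor $B\mapsto N(B)$ is represented by the Hopf algebra $N$ over $\mathbb{Z}$, which as an algebra is $\mathbb{Z}[x_1,x_2,\ldots]$, with diagonal dual to composition of power series: $\Delta(x_k)=\sum_{j=0}^{k}x_j\otimes c_{j,k}$, where $x_0=1$ and $c_{j,k}$ is the coefficient of $t^{k+1}$ in $(t+x_1t^2+x_2t^3+\ldots)^{j+1}$. The complete Landweber-Novikov algebra $\hat S$ is the (ungraded) $\mathbb{Z}$-dual $\mathrm{Hom}_{\mathbb{Z}}(N,\mathbb{Z})$ of $N$, a topological Hopf algebra over $\mathbb{Z}$ with the linear topology whose fundamental neighborhoods of $0$ are the annihilators of free finite rank submodules of $N$. $\hat S\hat\otimes R$ is the completion of $\hat S\otimes R$ in the induced linear topology; it is identified with $\mathrm{Hom}_{\mathbb{Z}}(N,R)=\mathrm{Hom}_R(N\otimes R,R)$, with fundamental neighborhoods of $0$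 the annihilators of free finite rank $R$-submodules of $N\otimes R$. Its product is convolution, dual to $\Delta$ (that is, $(fg)(a)=(f\otimes g)(\Delta a)$ followed by multiplication in $R$), and its continuous coproduct $\mathrm{Hom}_{\mathbb Z}(N,R)\to \mathrm{Hom}_{\mathbb Z}(N\otimes N,R)$, with values in the completed tensor square, is dual to the multiplication of $N$. The group algebra $R[N(Q)]$ carries its usual Hopf algebra structure over $R$, in which group elements are grouplike. The assertion is that there is an injective $R$-linear map $R[N(Q)]\to\mathrm{Hom}_{\mathbb Z}(N,R)$ compatible with the Hopf algebra structures and with dense image. *)

(* Defs.v *)
From HB Require Import structures.
From mathcomp Require Import all_boot all_algebra.
From mathcomp Require Import finmap.
From mathcomp Require Import boolp classical_sets functions topology.
(* The notations of monalg are incompatible with those of topology. *)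
From mathcomp.multinomials Require Import -(notations) monalg.

Set Implicit Arguments.
Unset Strict Implicit.
Unset Printing Implicit Defensive.

Import GRing.Theory.

Local Open Scope classical_set_scope.
Local Open Scope ring_scope.

(* A series x(t) = t + x_1 t^2 + x_2 t^3 + ... is recorded by k |-> x_(k+1). *)
Record nott (B : comNzRingType) := Nott { ncoef : nat -> B }.

HB.instance Definition _ (B : comNzRingType) := gen_eqMixin (nott B).
HB.instance Definition _ (B : comNzRingType) := gen_choiceMixin (nott B).

Section NottGroup.
Variable B : comNzRingType.
Implicit Types (x y z : nott B) (p q : {poly B}).

(* The coefficient of t^m in x(t); thus x_k (with x_0 = 1) is tcoef x k.+1. *)
Definition tcoef x (m : nat) : B :=
  match m with 0 => 0 | 1 => 1 | k.+2 => ncoef x k end.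

(* The coefficient c_(j,k) of t^(k+1) in x(t)^(j+1): only the terms of x(t) of
   degree at most k+1 contribute to it. *)
Definition ccoef x (j k : nat) : B :=
  ((\poly_(m < k.+2) tcoef x m) ^+ j.+1)`_k.+1.

(* x(y(t)) *)
Definition ncomp x y : nott B :=
  Nott (fun k => \sum_(j < k.+2) tcoef x j.+1 * ccoef y j k.+1).

Definition nid : nott B := Nott (fun=> 0).

(* [:: y_0; ...; y_n] for the series y with y(x(t)) = t, by solving for y_n in
   sum_(j <= n) y_j c_(j,n) = 0, where c_(n,n) = 1. *)
Fixpoint ninv_rec x (n : nat) : seq B :=
  if n is n'.+1 then
    let s := ninv_rec x n' in rcons s (- \sum_(j < n) s`_j * ccoef x j n)
  else [:: 1].

Definition ninv x : nott B := Nott (fun k => (ninv_rec x k.+1)`_k.+1).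

Lemma nottP x y : ncoef x =1 ncoef y -> x = y.
Proof. by case: x y => [x] [y] /= xy; congr Nott; apply/funext. Qed.

Let T n x : {poly B} := \poly_(m < n) tcoef x m.

Let eqm n p q := forall i, (i < n)%N -> p`_i = q`_i.

Let eqmM n p p' q q' : eqm n p p' -> eqm n q q' -> eqm n (p * q) (p' * q').
Proof.
move=> pp' qq' i lt_in; rewrite !coefM; apply: eq_bigr => j _.
by rewrite pp' ?qq' // (leq_ltn_trans _ lt_in) // ?leq_subr // -ltnS.
Qed.

Let eqmX n p q k : eqm n p q -> eqm n (p ^+ k) (q ^+ k).
Proof. by move=> pq; elim: k => // k IH; rewrite !exprS; apply: eqmM. Qed.

Let coefX0 q j m : q`_0 = 0 -> (m < j)%N -> (q ^+ j)`_m = 0.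
Proof.
elim/poly_ind: q => [|q c _]; first by case: j => // j _ _; rewrite expr0n coef0.
rewrite coefD coefMX coefC add0r /= => ->; rewrite addr0 => lt_mj.
by rewrite exprMn coefMXn lt_mj.
Qed.

Let comp_coef p q m : q`_0 = 0 ->
  (p \Po q)`_m = \sum_(i < m.+1) p`_i * (q ^+ i)`_m.
Proof.
move=> q0; rewrite comp_polyE coef_sum.
under eq_bigr do rewrite coefZ.
pose F i := p`_i * (q ^+ i)`_m; pose M := maxn (size p) m.+1.
rewrite (big_ord_widen M F) ?leq_maxl // [RHS](big_ord_widen M F) ?leq_maxr //.
rewrite big_mkcond [RHS]big_mkcond /=; apply: eq_bigr => i _; rewrite /F.
case: ltnP => [_|le_pi]; case: ltnP => [|lt_mi] //; first by rewrite coefX0 ?mulr0.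
by rewrite nth_default ?mul0r.
Qed.

Let eqm_comp n p p' q q' : q`_0 = 0 -> q'`_0 = 0 -> eqm n p p' -> eqm n q q' ->
  eqm n (p \Po q) (p' \Po q').
Proof.
move=> q0 q'0 pp' qq' i lt_in; rewrite !comp_coef //; apply: eq_bigr => j _.
rewrite pp' ?(eqmX j qq') //; exact: leq_trans (ltn_ord j) lt_in.
Qed.

Let T0 n x : (T n x)`_0 = 0.
Proof. by rewrite coef_poly /=; case: ifP. Qed.

Let eqmT n m x : (n <= m)%N -> eqm n (T m x) (T n x).
Proof. by move=> le_nm i lt_in; rewrite !coef_poly lt_in (leq_trans lt_in). Qed.

Let eqmT_comp n x y : eqm n (T n (ncomp x y)) (T n x \Po T n y).
Proof.
move=> m lt_mn; rewrite coef_poly lt_mn comp_coef ?T0 //.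
rewrite big_ord_recl T0 mul0r add0r.
have cE j : ((T n y) ^+ j.+1)`_m = ((T m.+1 y) ^+ j.+1)`_m.
  exact: (eqmX _ (eqmT y lt_mn)).
have aE (j : 'I_m) : (T n x)`_j.+1 = tcoef x j.+1.
  by rewrite coef_poly (leq_ltn_trans (ltn_ord j) lt_mn).
under eq_bigr do rewrite lift0 cE aE.
case: m {lt_mn aE} cE => [|[|k]] cE //=; first by rewrite big_ord0.
by rewrite big_ord1 expr1 coef_poly /= mul1r.
Qed.

Let nott_eq x y : (forall n, eqm n (T n x) (T n y)) -> x = y.
Proof.
move=> xy; apply: nottP => k; have := xy k.+3 k.+2 (ltnSn _).
by rewrite !coef_poly ltnSn.
Qed.

Lemma ncompA : associative ncomp.
Proof.
move=> x y z; apply: nott_eq => n i lt_in.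
rewrite (eqmT_comp x (ncomp y z)) // [RHS](eqmT_comp (ncomp x y) z) //.
have c0 u v : (T n u \Po T n v)`_0 = 0.
  by rewrite comp_coef ?T0 // big_ord1 T0 mul0r.
have -> : (T n x \Po T n (ncomp y z))`_i = (T n x \Po (T n y \Po T n z))`_i.
  by apply: (@eqm_comp n) => //; apply: eqmT_comp.
have -> : (T n (ncomp x y) \Po T n z)`_i = ((T n x \Po T n y) \Po T n z)`_i.
  by apply: (@eqm_comp n) => //; apply: eqmT_comp.
by rewrite comp_polyA.
Qed.

Let eqmT1 n : eqm n (T n nid) 'X.
Proof. by case=> [|[|i]] lt_in; rewrite coef_poly lt_in coefX. Qed.

Lemma ncomp1l : left_id nid ncomp.
Proof.
move=> x; apply: nott_eq => n i lt_in; rewrite eqmT_comp //.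
have -> : (T n nid \Po T n x)`_i = ('X \Po T n x)`_i.
  by apply: (@eqm_comp n) => //; apply: eqmT1.
by rewrite comp_polyX.
Qed.

Lemma ncomp1r : right_id nid ncomp.
Proof.
move=> x; apply: nott_eq => n i lt_in; rewrite eqmT_comp //.
have -> : (T n x \Po T n nid)`_i = (T n x \Po 'X)`_i.
  by apply: (@eqm_comp n); rewrite ?T0 ?coefX //; apply: eqmT1.
by rewrite comp_polyXr.
Qed.

Let size_ninv_rec x n : size (ninv_rec x n) = n.+1.
Proof. by elim: n => //= n IH; rewrite size_rcons IH. Qed.

Let nth_ninv_rec x n j : (j <= n)%N -> (ninv_rec x n)`_j = tcoef (ninv x) j.+1.
Proof.
elim: n => [|n IH]; first by rewrite leqn0 => /eqP->.
rewrite leq_eqVlt => /orP[/eqP-> //|lt_jn].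
by rewrite /= nth_rcons size_ninv_rec lt_jn IH.
Qed.

Let ccoef_diag x n : ccoef x n n = 1.
Proof.
rewrite /ccoef; set q := \poly_(m < _) _.
have q0 : q`_0 = 0 by rewrite coef_poly.
have q1 : q`_1 = 1 by rewrite coef_poly.
elim/poly_ind: (q) q0 q1 => [|p c _].
  by rewrite !coef0 => _ /esym/eqP; rewrite oner_eq0.
rewrite !coefD !coefMX !coefC add0r /= => -> p0; rewrite !addr0 in p0 *.
rewrite exprMn coefMXn ltnn subnn.
by elim: (n.+1) => [|k IH]; rewrite ?coef1 // exprS coef0M p0 IH mul1r.
Qed.

Lemma ncompVl : left_inverse nid ninv ncomp.
Proof.
move=> x; apply: nottP => k /=; rewrite big_ord_recr /= ccoef_diag mulr1.
rewrite nth_rcons size_ninv_rec ltnn eqxx.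
apply/eqP; rewrite subr_eq0; apply/eqP/eq_bigr => j _.
by rewrite nth_ninv_rec // -ltnS.
Qed.

Lemma ncompVr : right_inverse nid ninv ncomp.
Proof.
move=> x; rewrite -[ncomp x _]ncomp1l -{1}(ncompVl (ninv x)) -ncompA.
by rewrite [ncomp (ninv x) _]ncompA ncompVl ncomp1l ncompVl.
Qed.

End NottGroup.

HB.instance Definition _ (B : comNzRingType) := isGroup.Build (nott B)
  (@ncompA B) (@ncomp1l B) (@ncomp1r B) (@ncompVl B) (@ncompVr B).

(* For a ring A, malg K A is the free A-module on K, with basis mkmalgU k 1; it
   is the monoid algebra of K when K is a monoid, so that malg (cmonom I) A is
   the polynomial ring over A with variables indexed by I.  The tensor product
   of malg K1 A and malg K2 A is the free module malg (K1 * K2) A. *)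
Section PairMonomials.
Variables M1 M2 : conomType.

Definition pair_one : M1 * M2 := (one, one).
Definition pair_mul (m n : M1 * M2) : M1 * M2 :=
  (mul m.1 n.1, mul m.2 n.2).

Lemma pair_mulA : associative pair_mul.
Proof. by move=> [? ?] [? ?] [? ?]; rewrite /pair_mul /= !mulmA. Qed.
Lemma pair_mul1m : left_id pair_one pair_mul.
Proof. by move=> [? ?]; rewrite /pair_mul /= !mul1m. Qed.
Lemma pair_mulm1 : right_id pair_one pair_mul.
Proof. by move=> [? ?]; rewrite /pair_mul /= !mulm1. Qed.
Lemma pair_unitm m n :
  pair_mul m n = pair_one -> m = pair_one /\ n = pair_one.
Proof. by case: m n => [? ?] [? ?] [] /unitm[-> ->] /unitm[-> ->]. Qed.
Lemma pair_mulmC : commutative pair_mul.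
Proof. by move=> [a b] [c d]; rewrite /pair_mul /= (mulmC a) (mulmC b). Qed.

HB.instance Definition _ := Choice_isMonomialDef.Build (M1 * M2)%type
  pair_mulA pair_mul1m pair_mulm1 pair_unitm.
HB.instance Definition _ :=
  MonomialDef_isConomialDef.Build (M1 * M2)%type pair_mulmC.
End PairMonomials.

Definition mtens (A : nzRingType) (K1 K2 : choiceType)
    (u : malg K1 A) (v : malg K2 A) : malg (K1 * K2)%type A :=
  \sum_(k <- msupp u) \sum_(l <- msupp v)
    mkmalgU (k, l) (mcoeff k u * mcoeff l v).

(* The Hopf algebra representing B |-> nott B: the variable of index k is
   x_(k+1). *)
Notation LNalg := (malg (cmonom nat) int).
Notation LNalg2 := (malg (cmonom nat * cmonom nat)%type int).

Definition LNvar (k : nat) : LNalg := mkmalgU (ucm k) 1.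

Definition LNgeneric : nott LNalg := Nott LNvar.

Section Evaluation.
Variables (B : comNzRingType) (x : nott B).

Definition LNmonom (m : cmonom nat) : B :=
  \prod_(i <- finsupp m) ncoef x i ^+ m i.

Lemma LNmonomEw (d : {fset nat}) (m : cmonom nat) : (finsupp m `<=` d)%fset ->
  LNmonom m = \prod_(i <- d) ncoef x i ^+ m i.
Proof.
move=> le; rewrite [LHS](big_fset_incl _ le) // => i _.
by rewrite -cmE_eq0 => /eqP->; rewrite expr0.
Qed.

Lemma LNmonom_mmorphism : mmorphism LNmonom.
Proof.
split=> [m n|]; last by rewrite /LNmonom mdom1 big_seq_fset0.
rewrite (@LNmonomEw (finsupp m `|` finsupp n)%fset) ?mdomD ?fsubset_refl //.
rewrite [in RHS](LNmonomEw (fsubsetUl _ (finsupp n))).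
rewrite [in RHS](LNmonomEw (fsubsetUr (finsupp m) _)) -big_split /=.
by apply: eq_bigr => i _; rewrite cmM exprD.
Qed.

HB.instance Definition _ :=
  isMultiplicative.Build (cmonom nat) B LNmonom LNmonom_mmorphism.

(* The ring morphism sending x_k to the k-th coefficient of x. *)
Definition LNeval : LNalg -> B := mmap (intmul 1) LNmonom.

HB.instance Definition _ := GRing.RMorphism.on LNeval.

Lemma LNeval_var k : LNeval (LNvar k) = ncoef x k.
Proof.
by rewrite /LNeval /LNvar mmapU mul1r /LNmonom mdomU big_seq_fset1 cmUU expr1.
Qed.

End Evaluation.

(* Delta(x_k) = sum_(j <= k) x_j (x) c_(j,k) *)
Definition LNcomul : LNalg -> LNalg2 :=
  LNeval (Nott (fun k => \sum_(j < k.+2)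
    mtens (tcoef LNgeneric j.+1) (ccoef LNgeneric j k.+1))).
HB.instance Definition _ := GRing.RMorphism.on LNcomul.

(* The unit of the group scheme is the series t, its inverse the compositional
   one. *)
Definition LNcounit : LNalg -> int := LNeval 1%g.
HB.instance Definition _ := GRing.RMorphism.on LNcounit.

Definition LNantipode : LNalg -> LNalg := LNeval (LNgeneric^-1)%g.
HB.instance Definition _ := GRing.RMorphism.on LNantipode.

Definition LNmul : LNalg2 -> LNalg :=
  mmap (intmul 1) (fun m => mkmalgU m.1 1 * mkmalgU m.2 1).
HB.instance Definition _ := GRing.Additive.on LNmul.

Lemma LNmul_tens (a b : LNalg) : LNmul (mtens a b) = a * b.
Proof.
have mulU (k l : cmonom nat) :
    mkmalgU k 1 * mkmalgU l 1 = mkmalgU (mul k l) 1 :> LNalg.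
  by rewrite malgM_def fgmulUU mulr1.
rewrite malgME /mtens raddf_sum; apply: eq_bigr => k _; rewrite raddf_sum.
apply: eq_bigr => l _; rewrite /= /LNmul mmapU mulU mulrzl.
by rewrite -[in RHS](intz (_ * _)) -raddfMz.
Qed.

(* Hom_Z(malg K int, R) *)
Record mdual (K : choiceType) (R : comNzRingType) := Mdual {
  mdual_fun :> {additive malg K int -> R}
}.

Section DualModule.
Variables (K : choiceType) (R : comNzRingType).
Implicit Types (f g h : mdual K R) (a b : R) (u : malg K R).

HB.instance Definition _ := gen_eqMixin (mdual K R).
HB.instance Definition _ := gen_choiceMixin (mdual K R).

Lemma mdualP f g : f =1 g -> f = g.
Proof.
case: f g => [[f [[fP]]]] [[g [[gP]]]] /= /funext fg.
by case: _ / fg in gP *; rewrite (Prop_irrelevance fP gP).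
Qed.

Definition mdual0 : mdual K R := Mdual \0.
Definition mdual_opp f : mdual K R := Mdual (\- f).
Definition mdual_add f g : mdual K R := Mdual (f \+ g).
Definition mdual_scale a f : mdual K R := Mdual (a \*o f).

Lemma mdual_addA : associative mdual_add.
Proof. by move=> f g h; apply: mdualP => x /=; rewrite addrA. Qed.
Lemma mdual_addC : commutative mdual_add.
Proof. by move=> f g; apply: mdualP => x /=; rewrite addrC. Qed.
Lemma mdual_add0 : left_id mdual0 mdual_add.
Proof. by move=> f; apply: mdualP => x /=; rewrite add0r. Qed.
Lemma mdual_addN : left_inverse mdual0 mdual_opp mdual_add.
Proof. by move=> f; apply: mdualP => x /=; rewrite addNr. Qed.

HB.instance Definition _ := GRing.isZmodule.Build (mdual K R)
  mdual_addA mdual_addC mdual_add0 mdual_addN.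

Lemma mdual_scaleA a b f :
  mdual_scale a (mdual_scale b f) = mdual_scale (a * b) f.
Proof. by apply: mdualP => x /=; rewrite mulrA. Qed.
Lemma mdual_scale1 : left_id 1 mdual_scale.
Proof. by move=> f; apply: mdualP => x /=; rewrite mul1r. Qed.
Lemma mdual_scaleDr : right_distributive mdual_scale +%R.
Proof. by move=> a f g; apply: mdualP => x /=; rewrite mulrDr. Qed.
Lemma mdual_scaleDl f : {morph mdual_scale^~ f : a b / a + b}.
Proof. by move=> a b; apply: mdualP => x /=; rewrite mulrDl. Qed.

HB.instance Definition _ := GRing.Zmodule_isLmodule.Build R (mdual K R)
  mdual_scaleA mdual_scale1 mdual_scaleDr mdual_scaleDl.

(* The isomorphism Hom_Z(N, R) = Hom_R(N (x) R, R), for N = malg K int and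
   N (x) R = malg K R. *)
Definition mdual_ext f u : R := mmap idfun (fun k => f (mkmalgU k 1)) u.

Definition free_family n (v : 'I_n -> malg K R) : Prop :=
  forall c : 'I_n -> R, \sum_(i < n) c i *: v i = 0 -> forall i, c i = 0.

(* The annihilator of the R-submodule spanned by v. *)
Definition annihilator n (v : 'I_n -> malg K R) : set (mdual K R) :=
  [set f | forall c : 'I_n -> R, mdual_ext f (\sum_(i < n) c i *: v i) = 0].

Definition mdual_nbhs f : set_system (mdual K R) :=
  [set A | exists n (v : 'I_n -> malg K R),
     free_family v /\ [set g | annihilator v (g - f)] `<=` A].

Lemma mdual_ext0l u : mdual_ext 0 u = 0.
Proof. by rewrite /mdual_ext mmapE big1 // => k _; rewrite mulr0. Qed.

Lemma mdual_extDl f g u : mdual_ext (f + g) u = mdual_ext f u + mdual_ext g u.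
Proof.
rewrite /mdual_ext !mmapE -big_split /=; apply: eq_bigr => k _.
exact: mulrDr.
Qed.

Lemma mdual_ext_supp f u :
  (forall k, k \in msupp u -> f (mkmalgU k 1) = 0) -> mdual_ext f u = 0.
Proof.
move=> f0; rewrite /mdual_ext mmapE big_seq big1 // => k /f0 ->.
by rewrite mulr0.
Qed.

Lemma annihilator0 n (v : 'I_n -> malg K R) : annihilator v 0.
Proof. by move=> c; rewrite mdual_ext0l. Qed.

Lemma annihilatorD n (v : 'I_n -> malg K R) f g :
  annihilator v f -> annihilator v g -> annihilator v (f + g).
Proof. by move=> fv gv c; rewrite mdual_extDl fv gv addr0. Qed.

Definition basis_family (E : {fset K}) : 'I_(size E) -> malg K R :=
  fun i => mkmalgU (tnth (in_tuple E) i) 1.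

Lemma free_basis_family E : free_family (@basis_family E).
Proof.
move=> c c0 i; have := congr1 (mcoeff (tnth (in_tuple E) i)) c0.
rewrite mcoeff0 raddf_sum (bigD1 i) //= mcoeffZ mcoeffUU mulr1 big1 ?addr0 //.
move=> j ne_ji; rewrite mcoeffZ mcoeffU (inj_eq (tuple_uniqP _ _)) ?fset_uniq //.
by rewrite (negPf ne_ji) mulr0.
Qed.

Lemma annihilator_basis n (v : 'I_n -> malg K R) E :
    (forall i, msupp (v i) `<=` E)%fset ->
  annihilator (@basis_family E) `<=` annihilator v.
Proof.
move=> vE f fE c; apply: mdual_ext_supp => k; rewrite -mcoeff_neq0.
have [/(nthP k)[i lt_iE <-] _|kE] := boolP (k \in enum_fset E); last first.
  rewrite raddf_sum big1 ?eqxx // => i _; apply: mcoeff_outdom.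
  apply: contra kE => /(fsubsetP (msuppZ_le _ _)).
  by move/(fsubsetP (vE i)).
have := fE (fun j => (j == Ordinal lt_iE)%:R).
rewrite (bigD1 (Ordinal lt_iE)) //= eqxx scale1r big1 ?addr0; last first.
  by move=> j /negPf->; rewrite scale0r.
by rewrite /mdual_ext mmapU mul1r (tnth_nth k).
Qed.

HB.instance Definition _ := hasNbhs.Build (mdual K R) mdual_nbhs.

Lemma mdual_nbhs_filter f : ProperFilter (nbhs f).
Proof.
split; [|split].
- by move=> [n [v [_ /(_ f)]]]; apply; rewrite /= subrr; apply: annihilator0.
- by exists 0, (fun=> 0); split=> [c _ []|].
- move=> A B [n [v [_ vA]]] [m [w [_ wB]]].
  pose E := fsetU (\big[fsetU/fset0]_(i < n) msupp (v i))
                  (\big[fsetU/fset0]_(i < m) msupp (w i)).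
  exists (size E), (@basis_family E); split; first exact: free_basis_family.
  move=> g gE; split; [apply: vA | apply: wB];
    apply: annihilator_basis gE => i; apply/fsubsetP => k ki;
    rewrite in_fsetU; apply/orP; [left | right];
    by apply/bigfcupP; exists i; rewrite ?mem_index_enum.
- move=> A B AB [n [v [vfree vA]]]; exists n, v; split=> //.
  exact: subset_trans vA AB.
Qed.

Lemma mdual_nbhs_singleton f (A : set (mdual K R)) : nbhs f A -> A f.
Proof.
by move=> [n [v [_]]]; apply; rewrite /= subrr; apply: annihilator0.
Qed.

Lemma mdual_nbhs_nbhs f (A : set (mdual K R)) :
  nbhs f A -> nbhs f (nbhs^~ A).
Proof.
move=> [n [v [vfree vA]]]; exists n, v; split=> // g gf.
exists n, v; split=> // h hg; apply: vA => /=.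
by rewrite -(subrK g h) -addrA; apply: annihilatorD.
Qed.

HB.instance Definition _ := Nbhs_isNbhsTopological.Build (mdual K R)
  mdual_nbhs_filter mdual_nbhs_singleton mdual_nbhs_nbhs.
End DualModule.

Arguments free_family {K R n}.
Arguments annihilator {K R n}.

(* f (x) g, with values multiplied in R *)
Definition mdual_tens (K1 K2 : choiceType) (R : comNzRingType)
    (f : mdual K1 R) (g : mdual K2 R) : mdual (K1 * K2)%type R :=
  Mdual (mmap (intmul 1) (fun p => f (mkmalgU p.1 1) * g (mkmalgU p.2 1))).

Lemma mdual_tensE (K1 K2 : choiceType) (R : comNzRingType)
    (f : mdual K1 R) (g : mdual K2 R) a b :
  mdual_tens f g (mtens a b) = f a * g b.
Proof.
have E (K : choiceType) (h : mdual K R) u :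
    h u = \sum_(k <- msupp u) (mcoeff k u)%:~R * h (mkmalgU k 1).
  rewrite [in LHS](monalgE u) raddf_sum; apply: eq_bigr => k _.
  by rewrite /= mulrzl -[in LHS](intz (mcoeff k u)) !raddfMz.
rewrite /mtens raddf_sum (E _ f a) big_distrl; apply: eq_bigr => k _ /=.
rewrite raddf_sum (E _ g b) big_distrr; apply: eq_bigr => l _ /=.
by rewrite mmapU /= intrM mulrACA.
Qed.

(* The topological Hopf algebra Hom_Z(N, R); the completed tensor square in which
   its coproduct takes its values is Hom_Z(N (x) N, R). *)
Notation LNdual := (mdual (cmonom nat)).
Notation LNdual2 := (mdual (cmonom nat * cmonom nat)%type).

Section DualHopf.
Variable R : comNzRingType.
Implicit Types f g : LNdual R.

Definition LNdual_one : LNdual R := Mdual (intmul 1 \o LNcounit).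
Definition LNdual_mul f g : LNdual R := Mdual (mdual_tens f g \o LNcomul).
Definition LNdual_counit f : R := f 1.
Definition LNdual_comul f : LNdual2 R := Mdual (f \o LNmul).
Definition LNdual_antipode f : LNdual R := Mdual (f \o LNantipode).

End DualHopf.

(* The Hopf algebra structure on the group algebra R[G] = malg G R. *)
Section GroupAlgebra.
Variables (G : groupType) (R : comNzRingType).
Implicit Types u v : malg G R.

Definition galg_one : malg G R := mkmalgU 1%g 1.
Definition galg_mul u v : malg G R :=
  \sum_(g <- msupp u) \sum_(h <- msupp v)
    mkmalgU (g * h)%g (mcoeff g u * mcoeff h v).
Definition galg_counit u : R := \sum_(g <- msupp u) mcoeff g u.
Definition galg_comul u : malg (G * G)%type R :=
  \sum_(g <- msupp u) mkmalgU (g, g) (mcoeff g u).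
Definition galg_antipode u : malg G R :=
  \sum_(g <- msupp u) mkmalgU (g^-1)%g (mcoeff g u).

Variable phi : {linear malg G R -> LNdual R}.

(* phi (x) phi : R[G] (x) R[G] -> Hom_Z(N (x) N, R) *)
Definition galg_tens_map (w : malg (G * G)%type R) : LNdual2 R :=
  \sum_(p <- msupp w)
    mcoeff p w *: mdual_tens (phi (mkmalgU p.1 1)) (phi (mkmalgU p.2 1)).

Definition hopf_morphism : Prop :=
  [/\ phi galg_one = LNdual_one R,
      {morph phi : u v / galg_mul u v >-> LNdual_mul u v},
      forall u, LNdual_counit (phi u) = galg_counit u,
      forall u, LNdual_comul (phi u) = galg_tens_map (galg_comul u) &
      {morph phi : u / galg_antipode u >-> LNdual_antipode u}].

End GroupAlgebra.

(* R is an extension of its subring Q, seen as a type embedded in R by \val. *)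
Definition DS_extension (R : idomainType) (S : {pred R})
    (Q : subComNzRingType S) : Prop :=
  exists q : nat -> Q, forall i j : nat,
    i != j -> \val (q i) - \val (q j) \is a GRing.unit.

(* Main.v *)
Require Import Defs.
From HB Require Import structures.
From mathcomp Require Import all_boot all_algebra finmap.
From mathcomp Require Import boolp classical_sets functions topology.
From mathcomp.multinomials Require Import -(notations) monalg.

(** An element g of N(Q) is an R-valued point of the scheme represented by N,
    that is, a ring morphism N -> R: evaluation of the polynomials in the x_k at
    the coefficients of g.  The map sought is the R-linear extension of
    g |-> (evaluation at g), a map from R[N(Q)] to Hom_Z(N, R).

    It respects the Hopf structures because the structure maps of N represent
    the group law: convolving two points gives their composite [LNpointM],
    composing a point with the antipode gives its inverse [LNpointV], and a
    point, being multiplicative, is grouplike [LNpoint_comul].  The first two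
    facts compare ring morphisms out of N, so it is enough to compare them on the
    generators, where the formulas for the coproduct and for the antipode are
    those of composition and inversion of series, applied to the generic series.
    All operations are R-(bi)linear, which extends the result from points to
    R[N(Q)] [LNpoint_lin_hopf].

    Injectivity is the linear independence of distinct characters with values in
    a domain [rmorph_independent]; evaluations at distinct series differ at some
    generator.

    Density means that finitely many values on monomials can be prescribed
    arbitrarily.  The monomials in question involve x_1, ..., x_D with exponents
    below D, for some D.  On the grid of the series with coefficients in
    {q_0, ..., q_(D-1)}, the matrix of the values of these monomials is the D-th
    tensor power of the Vandermonde matrix (q_s^a).  The determinant of the
    latter is a product of differences q_i - q_j, hence a unit in R, and the
    tensor power of its inverse gives combinations of grid points dual to the
    monomials [LNpoint_lin_dual_monom].  This is the only use of the
    DS-condition. *)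

Set Implicit Arguments.
Unset Strict Implicit.
Unset Printing Implicit Defensive.

Import GRing.Theory.

Local Open Scope classical_set_scope.
Local Open Scope ring_scope.

(** * Linear maps out of a free module *)

Section FreeModule.
Variables (K : choiceType) (R : nzRingType) (V : lmodType R).
Implicit Types (u v : malg K R) (h : K -> V).

Definition malg_lin h u : V := \sum_(k <- msupp u) mcoeff k u *: h k.

(** Two elements with different supports can be compared as sums over a common
    larger set, which gives linearity. *)
Lemma malg_linEw h (d : {fset K}) u : (msupp u `<=` d)%fset ->
  malg_lin h u = \sum_(k <- d) mcoeff k u *: h k.
Proof.
move=> le; apply: (big_fset_incl _ le) => k _ /mcoeff_outdom ->.
by rewrite scale0r.
Qed.

Lemma malg_lin_is_linear h : linear (malg_lin h).
Proof.
move=> a u v; pose d := (msupp u `|` msupp v)%fset.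
have ud : (msupp u `<=` d)%fset := fsubsetUl _ _.
have vd : (msupp v `<=` d)%fset := fsubsetUr _ _.
have auvd : (msupp (a *: u + v)%R `<=` d)%fset.
  by apply: fsubset_trans (msuppD_le _ _) _; apply: fsetSU; apply: msuppZ_le.
rewrite (malg_linEw _ ud) (malg_linEw _ vd) (malg_linEw _ auvd).
rewrite scaler_sumr -big_split; apply: eq_bigr => k _ /=.
by rewrite mcoeffD mcoeffZ scalerDl scalerA.
Qed.

HB.instance Definition _ h :=
  GRing.isLinear.Build R (malg K R) V _ (malg_lin h) (malg_lin_is_linear h).

Lemma malg_linU h k c : malg_lin h (mkmalgU k c) = c *: h k.
Proof. by rewrite (malg_linEw _ msuppU_le) big_seq_fset1 mcoeffUU. Qed.

End FreeModule.

(** Stated for a bare function with a proof of linearity, so that it applies to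
    each argument of a bilinear operation without naming the partial
    applications. *)
Lemma linear_combE (R : nzRingType) (V W : lmodType R) (F : V -> W)
    (I : Type) (s : seq I) (c : I -> R) (h : I -> V) : linear F ->
  F (\sum_(i <- s) c i *: h i) = \sum_(i <- s) c i *: F (h i).
Proof.
move=> linF; elim: s => [|i s IH]; last by rewrite !big_cons linF IH.
rewrite !big_nil; have := linF (-1) 0 0.
by rewrite scaler0 addr0 scaleN1r addNr.
Qed.

(** * Ring morphisms out of the Landweber-Novikov Hopf algebra *)

Lemma additive_malg_int_eq (K : choiceType) (V : zmodType)
    (f g : {additive malg K int -> V}) :
  (forall k, f (mkmalgU k 1) = g (mkmalgU k 1)) -> f =1 g.
Proof.
move=> fg u; rewrite (monalgE u) !raddf_sum; apply: eq_bigr => k _ /=.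
by rewrite -[mcoeff k u]intz !raddfMz fg.
Qed.

Lemma cmonom_ind (I : choiceType) (P : cmonom I -> Prop) :
  P one -> (forall i m, P m -> P (mul (ucm i) m)) -> forall m, P m.
Proof.
move=> P1 PM m; have [n] := ubnP (mdeg m); elim: n m => // n IH m le_mn.
have [/eqP|m0] := posnP (mdeg m); first by rewrite mdeg_eq0 => /eqP->.
have [m1|[i im]] := fset_0Vmem (finsupp m).
  by move: m0; rewrite mdegE m1 big_seq_fset0.
have mE : m = mul (ucm i) (divcm m (ucm i)).
  apply/eqP/cmP => j; rewrite cmM divcmE cmU; case: eqP => [<-|_].
    by rewrite subnKC // lt0n cmE_neq0.
  by rewrite subn0.
rewrite mE; apply/PM/IH; move: le_mn; rewrite [in mdeg m]mE.
by rewrite mdegM mdegU add1n ltnS.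
Qed.

Lemma mkmalgU_mul (K : monomType) (R : nzRingType) (k l : K) :
  mkmalgU (mul k l) 1 = mkmalgU k 1 * mkmalgU l 1 :> malg K R.
Proof. by rewrite malgM_def fgmulUU mulr1. Qed.

(** The algebra N is generated by its variables: every monomial is reached from
    1 by multiplication by variables. *)
Lemma LNalg_rmorph_eq (B : comNzRingType) (f g : {rmorphism LNalg -> B}) :
  (forall k, f (LNvar k) = g (LNvar k)) -> f =1 g.
Proof.
move=> fg; apply: additive_malg_int_eq; elim/cmonom_ind => [|i m IH].
  exact: etrans (rmorph1 f) (esym (rmorph1 g)).
rewrite mkmalgU_mul.
apply: etrans (rmorphM f _ _) (etrans _ (esym (rmorphM g _ _))).
by congr (_ * _); [apply: fg | apply: IH].
Qed.

(** * Functoriality of the group of series *)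

Section NottMap.
Variables (A B : comNzRingType) (f : {rmorphism A -> B}).
Implicit Types x y : nott A.

Definition nott_map x : nott B := Nott (f \o ncoef x).

Lemma tcoef_map x m : tcoef (nott_map x) m = f (tcoef x m).
Proof. by case: m => [|[|m]] /=; rewrite ?rmorph0 ?rmorph1. Qed.

Lemma ccoef_map x j k : ccoef (nott_map x) j k = f (ccoef x j k).
Proof.
rewrite /ccoef -coef_map rmorphXn; congr (nth 0 (polyseq (_ ^+ _)) _).
apply/polyP => i; rewrite coef_map !coef_poly; case: ifP => _.
  by rewrite tcoef_map.
exact: esym (rmorph0 f).
Qed.

Lemma nott_mapM : {morph nott_map : x y / (x * y)%g}.
Proof.
move=> x y; apply: nottP => k /=; rewrite rmorph_sum; apply: eq_bigr => j _.
by rewrite rmorphM ccoef_map; congr (_ * _); apply: esym (tcoef_map x j.+1).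
Qed.

Lemma nott_map1 : nott_map 1%g = 1%g.
Proof. by apply: nottP => k /=; rewrite rmorph0. Qed.

Lemma nott_mapV : {morph nott_map : x / (x^-1)%g}.
Proof.
move=> x; apply: (@mulgI _ (nott_map x)).
by rewrite -nott_mapM !mulgV nott_map1.
Qed.

End NottMap.

(** Every series is the image of the generic one, so an identity involving the
    coefficients of the generic series specializes to all series. *)
Lemma nott_map_generic (B : comNzRingType) (x : nott B) :
  nott_map (LNeval x) LNgeneric = x.
Proof. by apply: nottP => k /=; rewrite LNeval_var. Qed.

Lemma LNeval_tcoef (B : comNzRingType) (x : nott B) m :
  LNeval x (tcoef LNgeneric m) = tcoef x m.
Proof. by rewrite -[in RHS](nott_map_generic x) tcoef_map. Qed.

Lemma LNeval_ccoef (B : comNzRingType) (x : nott B) j k :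
  LNeval x (ccoef LNgeneric j k) = ccoef x j k.
Proof. by rewrite -[in RHS](nott_map_generic x) ccoef_map. Qed.

Lemma nott_map_inj (A B : comNzRingType) (f : {rmorphism A -> B}) :
  injective f -> injective (nott_map f).
Proof.
move=> injf x y xy; apply: nottP => k; apply: injf.
exact: (congr1 (fun z => ncoef z k) xy).
Qed.

(** * Points of the group scheme as elements of the dual *)

Section Points.
Variable R : comNzRingType.
Implicit Types x y : nott R.

Definition LNpoint x : LNdual R := Mdual (LNeval x).

Lemma LNpoint_monom x m : LNpoint x (mkmalgU m 1) = LNmonom x m.
Proof. by rewrite /= /LNeval mmapU mul1r. Qed.

(** The character x (x) y of the tensor square: making it a monoid morphism
    shows that the tensor product of two points is again a ring morphism. *)
Definition pair_monom x y (p : cmonom nat * cmonom nat) : R :=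
  LNmonom x p.1 * LNmonom y p.2.

Lemma pair_monom_mmorphism x y : mmorphism (pair_monom x y).
Proof.
split=> [[a b] [c d]|]; rewrite /pair_monom /=; last first.
  by rewrite !mmorph1 mulr1.
by rewrite !mmorphM mulrACA.
Qed.

HB.instance Definition _ x y := isMultiplicative.Build
  (cmonom nat * cmonom nat)%type R (pair_monom x y) (pair_monom_mmorphism x y).

Lemma mdual_tens_point x y :
  mdual_tens (LNpoint x) (LNpoint y) =1 mmap (intmul 1) (pair_monom x y).
Proof.
move=> a; rewrite /mdual_tens /= !mmapE; apply: eq_bigr => p _.
by congr (_ * _); congr (_ * _); apply: LNpoint_monom.
Qed.

(** Both sides are ring morphisms out of N; on the variable x_(k+1) the right
    one is the sum over j of x_j times the coefficient of t^(k+2) in y(t)^(j+1),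
    that is, the coefficient of t^(k+2) in x(y(t)). *)
Lemma LNpointM x y : LNpoint (x * y)%g = LNdual_mul (LNpoint x) (LNpoint y).
Proof.
apply: mdualP => a.
rewrite -[RHS]/(mdual_tens (LNpoint x) (LNpoint y) (LNcomul a)).
rewrite mdual_tens_point.
pose F := mmap (intmul 1) (pair_monom x y) \o LNcomul.
apply: (@LNalg_rmorph_eq _ (LNeval (x * y)%g) F) => k.
rewrite [LHS]LNeval_var /F /= /LNcomul LNeval_var /= -mdual_tens_point.
rewrite raddf_sum.
apply: eq_bigr => j _; rewrite mdual_tensE.
congr (_ * _); first exact/esym/(LNeval_tcoef x j.+1).
exact/esym/LNeval_ccoef.
Qed.

Lemma LNpoint1 : LNpoint 1%g = LNdual_one R.
Proof.
apply: mdualP => a.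
apply: (@LNalg_rmorph_eq _ (LNeval 1%g) (intmul 1 \o LNcounit)) => k.
by rewrite [LHS]LNeval_var /= /LNcounit LNeval_var.
Qed.

(** The inverse is preserved by the group morphism that specializes the generic
    series to x. *)
Lemma LNpointV x : LNpoint (x^-1)%g = LNdual_antipode (LNpoint x).
Proof.
apply: mdualP => a.
apply: (@LNalg_rmorph_eq _ (LNeval x^-1%g) (LNeval x \o LNantipode)) => k.
have /(congr1 (fun z => ncoef z k)) := nott_mapV (LNeval x) LNgeneric.
rewrite nott_map_generic => xV; apply: etrans (LNeval_var _ _) _.
by apply: etrans (esym xV) _; rewrite /= /LNantipode LNeval_var.
Qed.

(** The coproduct is dual to the product of N, so this grouplike property says
    that the evaluation at x is multiplicative. *)
Lemma LNpoint_comul x :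
  LNdual_comul (LNpoint x) = mdual_tens (LNpoint x) (LNpoint x).
Proof.
have LRE p : LNeval x (LNmul (mkmalgU p 1)) =
    mdual_tens (LNpoint x) (LNpoint x) (mkmalgU p 1).
  rewrite mdual_tens_point mmapU mul1r /pair_monom -!LNpoint_monom.
  by rewrite [LNmul _]mmapU mul1r rmorphM.
apply: mdualP.
exact: (@additive_malg_int_eq _ _ (LNeval x \o LNmul) _ LRE).
Qed.

End Points.

(** * Linearity of the operations of the dual *)

Section DualLinearity.
Variable R : comNzRingType.

Lemma mdual_combE (K : choiceType) (I : Type) (s : seq I) (c : I -> R)
    (h : I -> mdual K R) a :
  (\sum_(i <- s) c i *: h i) a = \sum_(i <- s) c i * h i a.
Proof. exact: (@linear_combE R _ R^o (fun f : mdual K R => f a)). Qed.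

Lemma mdual_tens_linearr (K1 K2 : choiceType) (f : mdual K1 R) :
  linear (@mdual_tens K1 K2 R f).
Proof.
move=> a g h; apply: mdualP => w.
transitivity (a * mdual_tens f g w + mdual_tens f h w) => //=.
rewrite !mmapE mulr_sumr -big_split; apply: eq_bigr => p _ /=.
by rewrite mulrDr mulrDr !(mulrCA a).
Qed.

Lemma mdual_tens_linearl (K1 K2 : choiceType) (g : mdual K2 R) :
  linear ((@mdual_tens K1 K2 R)^~ g).
Proof.
move=> a f h; apply: mdualP => w.
transitivity (a * mdual_tens f g w + mdual_tens h g w) => //=.
rewrite !mmapE mulr_sumr -big_split; apply: eq_bigr => p _ /=.
by rewrite mulrDl mulrDr -!mulrA !(mulrCA a).
Qed.

Lemma LNdual_mul_linearr (f : LNdual R) : linear (LNdual_mul f).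
Proof.
move=> a g h; apply: mdualP => w.
have E := mdual_tens_linearr f a g h.
exact: (f_equal (fun F : LNdual2 R => F (LNcomul w)) E).
Qed.

Lemma LNdual_mul_linearl (g : LNdual R) : linear ((@LNdual_mul R)^~ g).
Proof.
move=> a f h; apply: mdualP => w.
have E := mdual_tens_linearl g a f h.
exact: (f_equal (fun F : LNdual2 R => F (LNcomul w)) E).
Qed.

Lemma LNdual_comul_linear : linear (@LNdual_comul R).
Proof. by move=> a f g; apply: mdualP. Qed.

Lemma LNdual_antipode_linear : linear (@LNdual_antipode R).
Proof. by move=> a f g; apply: mdualP. Qed.

End DualLinearity.

(** * The morphism of Hopf algebras *)

Section PointMap.
Variables (B R : comNzRingType) (f : {rmorphism B -> R}).

Definition LNpoint_at (g : nott B) : LNdual R := LNpoint (nott_map f g).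

Definition LNpoint_lin : {linear malg (nott B) R -> LNdual R} :=
  malg_lin LNpoint_at.

Lemma LNpoint_linE u :
  LNpoint_lin u = \sum_(g <- msupp u) mcoeff g u *: LNpoint_at g.
Proof. by []. Qed.

Lemma LNpoint_linU g c : LNpoint_lin (mkmalgU g c) = c *: LNpoint_at g.
Proof. exact: malg_linU. Qed.

(** By (bi)linearity each identity reduces to group elements, where it is one of
    the properties of points. *)
Lemma LNpoint_lin_hopf : hopf_morphism LNpoint_lin.
Proof.
split=> [|u v|u|u|u].
- by rewrite LNpoint_linU scale1r /LNpoint_at nott_map1 LNpoint1.
- rewrite (LNpoint_linE u) (LNpoint_linE v).
  rewrite (linear_combE _ _ _ (LNdual_mul_linearl _)) raddf_sum.
  apply: eq_bigr => g _ /=; rewrite (linear_combE _ _ _ (LNdual_mul_linearr _)).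
  rewrite scaler_sumr raddf_sum; apply: eq_bigr => h _ /=.
  by rewrite LNpoint_linU scalerA /LNpoint_at nott_mapM LNpointM.
- rewrite /LNdual_counit (LNpoint_linE u) mdual_combE.
  by apply: eq_bigr => g _; rewrite [LNpoint_at g 1]rmorph1 mulr1.
- rewrite (LNpoint_linE u).
  rewrite (linear_combE _ _ _ (@LNdual_comul_linear R)).
  rewrite -[galg_tens_map _ _]/(malg_lin (fun p =>
    mdual_tens (LNpoint_lin (mkmalgU p.1 1)) (LNpoint_lin (mkmalgU p.2 1))) _).
  rewrite raddf_sum; apply: eq_bigr => g _ /=.
  by rewrite malg_linU !LNpoint_linU !scale1r LNpoint_comul.
- rewrite (LNpoint_linE u).
  rewrite (linear_combE _ _ _ (@LNdual_antipode_linear R)) raddf_sum.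
  apply: eq_bigr => g _ /=.
  by rewrite LNpoint_linU /LNpoint_at nott_mapV LNpointV.
Qed.

End PointMap.

(** * Injectivity *)

(** Dedekind's independence of characters.  Given a relation and two characters
    that differ at a, the relation at a * b minus the value at a of the first
    character times the relation at b no longer involves that character;
    induction on the number of characters then applies. *)
Lemma rmorph_independent (A : nzRingType) (R : idomainType) (K : eqType)
    (chi : K -> {rmorphism A -> R}) (s : seq K) (c : K -> R) :
    (forall k l, chi k =1 chi l -> k = l) -> uniq s ->
  (forall a, \sum_(k <- s) c k * chi k a = 0) -> {in s, forall k, c k = 0}.
Proof.
move=> chi_inj; elim: s c => // k s IH c /= /andP[ks s_uniq] c0.
have cs0 : {in s, forall l, c l = 0}.
  move=> l ls; have kl : k != l by apply: contraNneq ks => ->.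
  have [a akl] : exists a, chi l a != chi k a.
    apply: contrapT => no_a; case/eqP: kl; apply: chi_inj => a.
    apply/eqP; apply: contrapT => /negP akl; apply: no_a; exists a.
    by rewrite eq_sym.
  apply/eqP; have : c l * (chi l a - chi k a) == 0.
    apply/eqP; apply: (IH (fun j => c j * (chi j a - chi k a))) => // b.
    have : \sum_(j <- k :: s) c j * (chi j a - chi k a) * chi j b = 0.
      transitivity (\sum_(j <- k :: s) c j * chi j (a * b) -
                    chi k a * \sum_(j <- k :: s) c j * chi j b); last first.
        by rewrite !c0 mulr0 subr0.
      rewrite mulr_sumr -sumrB; apply: eq_bigr => j _.
      by rewrite rmorphM mulrBr mulrBl !mulrA (mulrC (chi k a)).
    by rewrite big_cons subrr mulr0 mul0r add0r.
  by rewrite mulf_eq0 subr_eq0 (negPf akl) orbF.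
move=> l; rewrite inE => /predU1P[->|/cs0//].
have := c0 1; rewrite big_cons rmorph1 mulr1 big_seq big1 ?addr0 // => j js.
by rewrite cs0 // mul0r.
Qed.

Lemma LNpoint_lin_inj (B : comNzRingType) (R : idomainType)
    (f : {rmorphism B -> R}) : injective f -> injective (LNpoint_lin f).
Proof.
move=> f_inj; apply: raddf_inj => u u0.
apply/malgP => g; rewrite mcoeff0.
have [gu|/mcoeff_outdom//] := boolP (g \in msupp u).
apply: (@rmorph_independent LNalg R _ (fun g => LNeval (nott_map f g))
  (msupp u) (fun g => mcoeff g u)) gu => [x y xy||a].
- apply: (nott_map_inj f_inj); apply: nottP => k.
  by have := xy (LNvar k); rewrite /= !LNeval_var.
- exact: fset_uniq.
- have ua0 : LNpoint_lin f u a = 0 by rewrite [LNpoint_lin f u]u0.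
  by rewrite LNpoint_linE mdual_combE in ua0.
Qed.

(** * Density *)

Lemma Vandermonde_right_inverse (R : comUnitRingType) n (q : nat -> R) :
    (forall i j, i != j -> q i - q j \is a GRing.unit) ->
  exists L : 'M[R]_n, forall a b : 'I_n,
    \sum_(s < n) q s ^+ a * L s b = (a == b)%:R.
Proof.
move=> dq; pose V := Vandermonde n (\row_(s < n) q s).
have V_unit : V \in unitmx.
  rewrite unitmxE det_Vandermonde; apply: rpred_prod => i _.
  apply: rpred_prod => j lt_ij; rewrite !mxE; apply: dq.
  by rewrite gtn_eqF.
exists (invmx V) => a b; have := congr1 (fun M : 'M_n => M a b) (mulmxV V_unit).
by rewrite !mxE => <-; apply: eq_bigr => s _; rewrite !mxE.
Qed.

(** The monomials in x_1, ..., x_(n+1) with all exponents at most n.  One bound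
    serves for the variables and for the exponents, so that points of the grid
    and monomials are both indexed by functions from 'I_n.+1 to itself. *)
Definition bounded_monom n (m : cmonom nat) : Prop :=
  {in finsupp m, forall i, (maxn i (m i) <= n)%N}.

Lemma bounded_monom_exists (E : seq (cmonom nat)) :
  exists n, {in E, forall m, bounded_monom n m}.
Proof.
pose w (m : cmonom nat) := (\max_(i <- finsupp m) maxn i (m i))%N.
exists (\max_(m <- E) w m)%N => m mE i im.
apply: leq_trans (leq_bigmax_seq m mE isT).
exact: (leq_bigmax_seq i im isT).
Qed.

Lemma bounded_monom_le n m i : bounded_monom n m -> (m i <= n)%N.
Proof.
move=> mn; have [/mn|] := boolP (i \in finsupp m).
  by rewrite geq_max => /andP[].
by rewrite -cmE_eq0 => /eqP->.
Qed.

Lemma bounded_monom_eq0 n m i : bounded_monom n m -> (n < i)%N -> m i = 0%N.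
Proof.
move=> mn lt_ni; apply/eqP; rewrite cmE_eq0; apply/negP => /mn.
by rewrite geq_max leqNgt lt_ni.
Qed.

Lemma LNmonom_bounded (B : comNzRingType) (x : nott B) n m :
  bounded_monom n m -> LNmonom x m = \prod_(i < n.+1) ncoef x i ^+ m i.
Proof.
move=> mn; pose d := seq_fset tt (index_iota 0 n.+1).
rewrite (LNmonomEw x (d := d)); last first.
  apply/fsubsetP => i /mn; rewrite geq_max seq_fsetE mem_index_iota ltnS.
  by case/andP.
rewrite -(big_mkord xpredT (fun i => ncoef x i ^+ m i)); apply: perm_big.
by apply: uniq_perm; rewrite ?fset_uniq ?iota_uniq // => i; rewrite seq_fsetE.
Qed.

Section Interpolation.
Variables (B : comNzRingType) (R : comUnitRingType) (f : {rmorphism B -> R}).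
Variable q : nat -> B.
Hypothesis dq : forall i j, i != j -> f (q i) - f (q j) \is a GRing.unit.

(** The coefficients of index above n are q (s ord0); they are never seen by the
    monomials bounded by n. *)
Definition grid_point n (s : {ffun 'I_n.+1 -> 'I_n.+1}) : nott B :=
  Nott (fun i => q (s (inord i))).

(** The family dual to the bounded monomials, given by the tensor power of the
    inverse Vandermonde matrix. *)
Lemma LNpoint_lin_dual_monom n :
  exists U : cmonom nat -> malg (nott B) R, forall m0 m,
    bounded_monom n m0 -> bounded_monom n m ->
    LNpoint_lin f (U m0) (mkmalgU m 1) = (m == m0)%:R.
Proof.
have [L LE] := @Vandermonde_right_inverse R n.+1 (f \o q) dq.
exists (fun m0 : cmonom nat =>
  \sum_s mkmalgU (grid_point s) (\prod_i L (s i) (inord (m0 i)))).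
move=> m0 m m0n mn; rewrite raddf_sum.
under eq_bigr do rewrite /= LNpoint_linU.
rewrite mdual_combE.
transitivity (\sum_(s : {ffun 'I_n.+1 -> 'I_n.+1})
    \prod_i ((f \o q) (s i) ^+ m i * L (s i) (inord (m0 i)))).
  apply: eq_bigr => s _; rewrite LNpoint_monom (LNmonom_bounded _ mn) mulrC.
  by rewrite -big_split; apply: eq_bigr => i _ /=; rewrite inord_val.
(* The sum over the grid factors into one Vandermonde sum for each variable. *)
rewrite -(bigA_distr_bigA (fun i j : 'I_n.+1 =>
  (f \o q) j ^+ m i * L j (inord (m0 i)))).
transitivity (\prod_(i < n.+1) ((m i == m0 i)%:R : R)).
  apply: eq_bigr => i _; have := LE (inord (m i)) (inord (m0 i)).
  rewrite -val_eqE /= !inordK ?ltnS ?bounded_monom_le // => <-.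
have [->|ne] := eqVneq m m0; first by rewrite big1 // => i _; rewrite eqxx.
have [i mi] : exists i : 'I_n.+1, m i != m0 i.
  apply: contrapT => no_i; case/eqP: ne; apply/eqP/cmP => i.
  have [le_in|lt_ni] := leqP i n; last by rewrite !(bounded_monom_eq0 _ lt_ni).
  apply/eqP; apply: contrapT => /negP mi; apply: no_i.
  by exists (inord i); rewrite inordK.
by rewrite (bigD1 i) //= (negPf mi) mul0r.
Qed.

Lemma LNpoint_lin_interpolation (E : {fset cmonom nat}) (c : cmonom nat -> R) :
  exists u, {in E, forall m, LNpoint_lin f u (mkmalgU m 1) = c m}.
Proof.
have [n En] := bounded_monom_exists E.
have [U UE] := LNpoint_lin_dual_monom n.
exists (\sum_(k <- E) c k *: U k) => m mE.
rewrite (linear_combE _ _ _ (linearP (LNpoint_lin f))) mdual_combE.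
rewrite (big_fsetD1 m mE) /= UE ?eqxx ?mulr1; [|exact: En..].
rewrite big_seq big1 ?addr0 // => k; rewrite !inE => /andP[km kE].
by rewrite UE ?[m == k]eq_sym ?(negPf km) ?mulr0; [|exact: En..].
Qed.

(** A neighborhood of g contains every functional that agrees with g on a certain
    finite set of monomials: those in the supports of the family whose
    annihilator it contains up to translation by g. *)
Lemma LNpoint_lin_dense : dense (range (LNpoint_lin f)).
Proof.
move=> O [g Og] openO.
have [n [v [_ vO]]] : nbhs g O by apply: open_nbhs_nbhs.
pose E := (\big[fsetU/fset0]_(i < n) msupp (v i))%fset.
have [u uE] := LNpoint_lin_interpolation E (fun m => g (mkmalgU m 1)).
exists (LNpoint_lin f u); split; last by exists u.
apply: vO => c; apply: mdual_ext_supp => k.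
rewrite -mcoeff_neq0 => vk.
rewrite -[LHS]/(LNpoint_lin f u (mkmalgU k 1) - g (mkmalgU k 1)).
apply/eqP; rewrite subr_eq0; apply/eqP/uE.
apply: contraNT vk => kE; rewrite raddf_sum big1 // => i _.
rewrite /= mcoeffZ mcoeff_outdom ?mulr0 //; apply: contra kE => ki.
by apply/bigfcupP; exists i; rewrite ?mem_index_enum.
Qed.

End Interpolation.

Theorem proposition5p2 (R : idomainType) (S : {pred R})
    (Q : subComNzRingType S) (hDS : DS_extension Q) :
  exists phi : {linear malg (nott Q) R -> LNdual R},
    [/\ injective phi, hopf_morphism phi & dense (range phi)].
Proof.
have [q dq] := hDS; pose f : {rmorphism Q -> R} := \val.
exists (LNpoint_lin f); split.
- exact: LNpoint_lin_inj val_inj.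
- exact: LNpoint_lin_hopf.
- exact: (@LNpoint_lin_dense _ _ f q dq).
Qed.
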